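(* Fix an even degree $d$. There is a finite collection $\mathcal H_d$ of square multigraphs without isolated vertices, each having at most $d$ vertices, such that for every $n\ge d$ the square-graph cone in $\mathrm{PST}_{n,d}$ is generated by the symmetrizations of the graphs in $\mathcal H_d$ after adjoining isolated vertices (so as to have $n$ vertices). For the polynomial $\operatorname{disc}(P^{(n-r)})$ with $r\ge2$ fixed (the terminal problem of order $r$) one may take $d=r(r-1)$.
   Context: $P(t)=\prod_{i=1}^n(t-x_i)$ with indeterminate roots $x_1,\dots,x_n$; $\operatorname{disc}(P^{(n-r)})$ is viewed as a polynomial in $x_1,\dots,x_n$. $\mathrm{PST}_{n,d}$ is the real vector space of homogeneous symmetric translation-invariant polynomials of degree $d$ in $x_1,\dots,x_n$. For a loopless multigraph $G$ on the vertex set $\{1,\dots,n\}$ with chosen edge orientations, set $M_G=\prod_{(i,j)\in E(G)}(x_i-x_j)$ (edges counted with multiplicity) and define its symmetrization $\widetilde G=\sum_{\sigma\in S_n}M_G(x_{\sigma(1)},\dots,x_{\sigma(n)})$. A square multigraph (square graph) is a loopless multigraph in which every edge has even multiplicity. Its degree is its number of edges counted with multiplicity. The square-graph cone in $\mathrm{PST}_{n,d}$ is the set of all finite nonnegative real linear combinations of the $\widetilde G$ with $G$ a square graph of degree $d$ on $\{1,\dots,n\}$. Graphs on $v\le n$ vertices are regarded as graphs on $\{1,\dots,n\}$ by labelling their vertices and adjoining $n-v$ isolated vertices; the symmetrization does not depend on the labelling. *)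

(* Defs.v *)
(* MathComp with the multinomials library; R : realType is the field of reals. *)
From HB Require Import structures.
From mathcomp Require Import all_boot all_order all_algebra all_fingroup.
From mathcomp Require Import reals mpoly.

Set Implicit Arguments.
Unset Strict Implicit.
Unset Printing Implicit Defensive.

Import Order.TTheory GRing.Theory Num.Theory.
Local Open Scope ring_scope.

(* Loopless multigraphs on 'I_n, given by their adjacency matrices: A i j is
   the multiplicity of the edge {i, j}. *)
Definition mgraph_axiom n (A : 'M[nat]_n) : bool :=
  (A^T == A) && [forall i, A i i == 0%N].

Record mgraph n := MGraph { adj :> 'M[nat]_n; _ : mgraph_axiom adj }.

HB.instance Definition _ n := [isSub for @adj n].
HB.instance Definition _ n := [Equality of mgraph n by <:].

Lemma mgraph_sym n (G : mgraph n) i j : G i j = G j i.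
Proof. by case: G => A /= /andP[/eqP AT _]; rewrite -[in LHS]AT mxE. Qed.

Lemma mgraph_loopless n (G : mgraph n) i : G i i = 0%N.
Proof. by case: G => A /= /andP[_ /forallP/(_ i)/eqP]. Qed.

Definition mg_square n (G : mgraph n) : bool :=
  [forall i, forall j, ~~ odd (G i j)].

Definition mg_degree n (G : mgraph n) : nat :=
  (\sum_(i < n) \sum_(j < n | (i < j)%N) G i j)%N.

Definition no_isolated n (G : mgraph n) : bool :=
  [forall i, exists j, (0 < G i j)%N].

(* Vertices 0, ..., v-1 keep their labels and v, ..., n-1 are isolated; this is
   meaningful for v <= n only (for n < v it truncates G). *)
Definition adjoin_adj v (A : 'M[nat]_v) n : 'M[nat]_n :=
  \matrix_(i, j) match (insub (val i) : option 'I_v),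
                       (insub (val j) : option 'I_v) with
                 | Some a, Some b => A a b
                 | _, _ => 0%N
                 end.

Lemma adjoin_subproof v (G : mgraph v) n : mgraph_axiom (adjoin_adj G n).
Proof.
apply/andP; split.
  apply/eqP/matrixP => i j; rewrite !mxE.
  by case: insub => [a|]; case: insub => [b|] //; apply: mgraph_sym.
by apply/forallP => i; rewrite mxE; case: insub => [a|] //; rewrite mgraph_loopless.
Qed.

Definition adjoin_isolated v (G : mgraph v) n : mgraph n :=
  MGraph (adjoin_subproof G n).

Section Polynomials.
Variables (R : realType) (n : nat).

(* Every edge {i, j} with i < j is oriented from i to j.  For square graphs any
   other choice of orientations, common to parallel edges, gives the same
   product: see graph_monomial_orientation. *)
Definition graph_monomial (G : mgraph n) : {mpoly R[n]} :=
  \prod_(i < n) \prod_(j < n | (i < j)%N) ('X_i - 'X_j) ^+ G i j.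

Lemma graph_monomial_orientation (G : mgraph n) (o : rel 'I_n) :
  mg_square G -> (forall i j, i != j -> o i j = ~~ o j i) ->
  \prod_(i < n) \prod_(j < n | (i != j) && o i j)
     (('X_i - 'X_j : {mpoly R[n]}) ^+ G i j) = graph_monomial G.
Proof.
move=> sqG oP; pose F (i j : 'I_n) := ('X_i - 'X_j : {mpoly R[n]}) ^+ G i j.
have FC i j : F j i = F i j.
  rewrite /F -opprB mgraph_sym exprNn -signr_odd.
  by have /forallP/(_ i)/forallP/(_ j)/negPf-> := sqG; rewrite mul1r.
have cond (P : rel 'I_n) : \prod_(i < n) \prod_(j < n | P i j) F i j =
    \prod_(i < n) \prod_(j < n) (if P i j then F i j else 1).
  by apply: eq_bigr => i _; rewrite big_mkcond.
rewrite /graph_monomial !cond.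
transitivity (\prod_(i < n) \prod_(j < n)
   ((if (i < j)%N && o i j then F i j else 1) *
    (if (j < i)%N && o i j then F i j else 1))).
  apply: eq_bigr => i _; apply: eq_bigr => j _; rewrite -val_eqE /=.
  by case: ltngtP => //= _; case: (o _ _); rewrite ?mulr1 ?mul1r.
under eq_bigr do rewrite big_split.
rewrite big_split /= [X in _ * X]exchange_big /= -big_split.
apply: eq_bigr => i _; rewrite -big_split; apply: eq_bigr => j _ /=.
have [lt_ij|] := ltnP i j; last by rewrite mulr1.
by rewrite FC (oP i j) ?neq_ltn ?lt_ij //; case: (o _ _); rewrite ?mulr1 ?mul1r.
Qed.

Definition symmetrization (G : mgraph n) : {mpoly R[n]} :=
  \sum_(s : 'S_n) msym s (graph_monomial G).

Definition cone_generated_by (S : {mpoly R[n]} -> Prop) (p : {mpoly R[n]}) :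
    Prop :=
  exists k (c : 'I_k -> R) (q : 'I_k -> {mpoly R[n]}),
    (forall i, 0 <= c i /\ S (q i)) /\ p = \sum_(i < k) c i *: q i.

Definition square_graph_cone (d : nat) : {mpoly R[n]} -> Prop :=
  cone_generated_by (fun q => exists G : mgraph n,
    [/\ mg_square G, mg_degree G = d & q = symmetrization G]).

Definition collection_cone (H : seq {v : nat & mgraph v}) :
    {mpoly R[n]} -> Prop :=
  cone_generated_by (fun q => exists2 G, G \in H &
    q = symmetrization (adjoin_isolated (tagged G) n)).

(* R is infinite, so invariance under all real translations is invariance under
   translation by an indeterminate. *)
Definition translation_invariant (p : {mpoly R[n]}) : Prop :=
  forall c : R, p \mPo [tuple 'X_i + c%:MP | i < n] = p.

Definition PST (d : nat) (p : {mpoly R[n]}) : Prop :=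
  [/\ p \is d.-homog, p \is symmetric & translation_invariant p].

Definition generic_poly : {poly {mpoly R[n]}} :=
  \prod_(i < n) ('X - ('X_i)%:P).

End Polynomials.

Definition generates_square_cones (R : realType) (d : nat)
    (H : seq {v : nat & mgraph v}) : Prop :=
  forall n, (d <= n)%N -> forall p : {mpoly R[n]},
    square_graph_cone d p <-> collection_cone H p.

(* disc f = (-1)^(m(m-1)/2) a^-1 Res(f, f') for f of degree m with leading
   coefficient a, which must be a unit of A. *)
Definition disc (A : comUnitRingType) (f : {poly A}) : A :=
  (-1) ^+ 'C((size f).-1, 2) * (lead_coef f)^-1 * resultant f f^`().

(* Main.v *)
(* Every edge of a square graph has multiplicity at least 2, so a square graph
   of degree d has at most d non-isolated vertices; moving these to the front,
   which does not change the symmetrization, leaves finitely many graphs.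

   For the discriminant, let phi be a ring endomorphism with
   phi x_i = a x_(s i) + b for a permutation s.  Then phi P (a X + b) = a^n P,
   and the effect of an affine substitution on resultants gives
   phi (disc P^(n-r)) = a^(r(r-1)) disc P^(n-r).  The cases a = 2, s arbitrary,
   and b = c yield homogeneity, symmetry and translation invariance. *)
Require Import Defs.
From mathcomp Require Import all_boot all_order all_algebra all_fingroup.
From mathcomp Require Import reals mpoly.
From mathcomp Require Import zify.

Set Implicit Arguments.
Unset Strict Implicit.
Unset Printing Implicit Defensive.

Import Order.TTheory GRing.Theory Num.Theory.
Local Open Scope ring_scope.

(** * Resultants under scaling and affine substitution *)

Section AffineSubstitution.
Variable R : idomainType.
Implicit Types (p q : {poly R}) (a b c : R).

(** The block sizes are free parameters, so that Sylvester matrices of different polynomials can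
    share one type. *)
Let sylv m n p q : 'M[R]_(m + n) :=
  col_mx (lin1_mx (poly_rV \o p \o* rVpoly)) (lin1_mx (poly_rV \o q \o* rVpoly)).

Let resultantE m n p q : (size q).-1 = m -> (size p).-1 = n ->
  resultant p q = \det (sylv m n p q).
Proof. by move=> <- <-. Qed.

(** The Sylvester matrix is multiplied on the left by a block diagonal matrix with scalar blocks [c]
    and [d]. *)
Lemma resultantZ p q c d : c != 0 -> d != 0 ->
  resultant (c *: p) (d *: q) = c ^+ (size q).-1 * d ^+ (size p).-1 * resultant p q.
Proof.
move=> c0 d0; rewrite (@resultantE (size q).-1 (size p).-1) ?size_scale //.
rewrite (@resultantE (size q).-1 (size p).-1 p) //.
rewrite -!det_scalar -(det_ublock _ 0) -det_mulmx; congr (\det _).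
rewrite mul_block_col !mul0mx addr0 add0r !mul_scalar_mx.
by congr col_mx; apply/matrixP => i j; rewrite !mxE /= -scalerAr coefZ.
Qed.

(** For [l] of degree at most 1, this is the matrix of composition with [l] on polynomials of degree
    below [n]. *)
Let shift_mx n (l : {poly R}) : 'M[R]_n := \matrix_(i, j) (l ^+ i)`_j.

Let rVpoly_shift n (l : {poly R}) (v : 'rV[R]_n) : (size l <= 2)%N ->
  rVpoly (v *m shift_mx n l) = rVpoly v \Po l.
Proof.
move=> sl; rewrite [rVpoly v]poly_def linear_sum /=; apply/polyP => k.
rewrite coef_sum coef_rVpoly; case: insubP => [j _ <-|].
  rewrite !mxE; apply: eq_bigr => i _; rewrite !mxE linearZ coefZ /=.
  by rewrite rmorphXn /= comp_polyX valK.
rewrite -leqNgt => nk; rewrite big1 // => i _.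
rewrite linearZ coefZ /= rmorphXn /= comp_polyX nth_default ?mulr0 //.
apply: leq_trans (size_poly_exp_leq _ _) (leq_trans _ nk).
apply: leq_ltn_trans (ltn_ord i); rewrite -[leqRHS]mul1n leq_mul2r.
by case: (size l) sl => [|[|[]]] //=; rewrite orbT.
Qed.

Lemma size_affine a b : a != 0 -> size (a *: 'X + b%:P) = 2%N.
Proof.
by move=> a0; rewrite size_polyDl size_scale // size_polyX // size_polyC; case: eqP.
Qed.

(** Since [l ^+ i] has degree [i], the matrix is lower triangular with diagonal entries [a ^+ i] for
    [i < n]. *)
Let det_shift n a b : a != 0 -> \det (shift_mx n (a *: 'X + b%:P)) = a ^+ 'C(n, 2).
Proof.
move=> a0; set l := _ + _; have sl : size l = 2%N by apply: size_affine.
have ll : lead_coef l = a by rewrite lead_coefE sl coefD coefZ coefX coefC mulr1 addr0.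
have sle i : size (l ^+ i) = i.+1.
  have ps : (0 < size (l ^+ i))%N.
    by rewrite size_poly_gt0 expf_neq0 // -size_poly_eq0 sl.
  by rewrite -(prednK ps) size_exp sl mul1n.
rewrite det_trig; last first.
  by apply/is_trig_mxP => i j ij; rewrite mxE nth_default // sle.
rewrite -triangular_sum -prodrXr big_mkord; apply: eq_bigr => i _; rewrite mxE.
by have := lead_coef_exp l i; rewrite ll /lead_coef sle.
Qed.

(** The size bounds make both products fit into [m + n] coefficients, so [poly_rV] truncates
    nothing. *)
Let mulmx_sylv m n p q (v : 'rV[R]_(m + n)) : (size p <= n.+1)%N -> (size q <= m.+1)%N ->
  rVpoly (v *m sylv m n p q) = rVpoly (lsubmx v) * p + rVpoly (rsubmx v) * q.
Proof.
move=> sp sq; rewrite -[v in LHS]hsubmxK mul_row_col !mul_rV_lin1 /= -linearD /=.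
rewrite poly_rV_K //; apply: leq_trans (size_polyD _ _) _.
have sM k1 k2 (r s : {poly R}) :
    (size r <= k1)%N -> (size s <= k2.+1)%N -> (size (r * s)%R <= k1 + k2)%N.
  move=> h1 h2; apply: leq_trans (size_polyMleq _ _) _.
  by rewrite -subn1 leq_subLR add1n -addnS leq_add.
by rewrite geq_max sM ?size_poly // addnC sM ?size_poly.
Qed.

Let binD2 m n : 'C(m + n, 2) = ('C(m, 2) + 'C(n, 2) + n * m)%N.
Proof.
elim: m => [|m IH]; first by rewrite bin0n muln0 addn0.
by rewrite addSn !binS !bin1 IH; lia.
Qed.

Lemma resultant_comp_affine p q a b (l := a *: 'X + b%:P) : a != 0 ->
  resultant (p \Po l) (q \Po l) = a ^+ ((size p).-1 * (size q).-1) * resultant p q.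
Proof.
move=> a0; have sl : size l = 2%N by apply: size_affine.
set m := (size q).-1; set n := (size p).-1.
have sc r : (size (r \Po l)).-1 = (size r).-1 by rewrite size_comp_poly sl muln1.
rewrite (@resultantE m n) // (@resultantE m n) //.
(* The row vector (u, v) acts on the Sylvester matrix as u * p + v * q, and
   composition with l turns it into the same combination of composites. *)
have E : block_mx (shift_mx m l) 0 0 (shift_mx n l) *m sylv m n (p \Po l) (q \Po l)
         = sylv m n p q *m shift_mx (m + n) l.
  apply/row_matrixP => i; rewrite !rowE; move: (delta_mx _ _) => u.
  apply: (can_inj rVpolyK); rewrite !mulmxA rVpoly_shift ?sl //.
  have le r k : (size r).-1 = k -> (size r <= k.+1)%N by move=> <-; exact: leqSpred.
  rewrite !mulmx_sylv ?le //.
  rewrite -[u in _ (lsubmx (u *m _))]hsubmxK -[u in _ (rsubmx (u *m _))]hsubmxK.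
  rewrite mul_row_block !mulmx0 addr0 add0r row_mxKl row_mxKr.
  by rewrite !rVpoly_shift ?sl // comp_polyD !comp_polyM.
(* Cancelling the exponent ['C(m, 2) + 'C(n, 2)] of the diagonal blocks from ['C(m + n, 2)] leaves
   [n * m]. *)
have := congr1 determinant E.
rewrite !det_mulmx det_ublock !det_shift // -exprD [RHS]mulrC binD2 [in RHS]exprD -mulrA.
by move/(mulfI (expf_neq0 _ a0)).
Qed.

Lemma derivn_comp_affine p a b k (l := a *: 'X + b%:P) :
  (p \Po l)^`(k) = a ^+ k *: (p^`(k) \Po l).
Proof.
elim: k => [|k IH]; first by rewrite scale1r.
rewrite derivnS IH derivZ deriv_comp -derivnS derivD derivC addr0 derivZ derivX.
by rewrite -scalerAr mulr1 scalerA exprSr.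
Qed.

End AffineSubstitution.

(** Nonzero images of the leading coefficients preserve the sizes, hence the shape of the Sylvester
    matrix. *)
Lemma resultant_map (A B : idomainType) (phi : {rmorphism A -> B}) (p q : {poly A}) :
  phi (lead_coef p) != 0 -> phi (lead_coef q) != 0 ->
  resultant (map_poly phi p) (map_poly phi q) = phi (resultant p q).
Proof.
move=> p0 q0; rewrite /resultant /Sylvester_mx !size_map_poly_id0 //.
rewrite -det_map_mx map_col_mx; congr (\det (col_mx _ _));
  by apply/esym/map_lin1_mx => v; rewrite /= map_poly_rV rmorphM /= map_rVpoly.
Qed.

(** * Discriminants of derivatives of a split monic polynomial *)

Section DiscDerivnProd.
Variables (A : idomainType) (n : nat) (x : 'I_n -> A).
Hypothesis natA_unit : forall k, (0 < k)%N -> k%:R \is a @GRing.unit A.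

Let natA_neq0 k : (0 < k)%N -> k%:R != 0 :> A.
Proof. by move/natA_unit; apply: contraTneq => ->; rewrite unitr0. Qed.

Let P := \prod_(i < n) ('X - (x i)%:P).

Let size_P : size P = n.+1.
Proof. by rewrite size_prod_XsubC /index_enum -enumT size_enum_ord. Qed.

Lemma size_derivn_prod_XsubC r : (r <= n)%N -> size P^`(n - r) = r.+1.
Proof.
move=> rn; apply/eqP; rewrite eqn_leq; apply/andP; split.
  apply/leq_sizeP => j rj; rewrite coef_derivn nth_default ?mul0rn //.
  by rewrite size_P; lia.
rewrite ltnNge; apply/negP => /leq_sizeP/(_ _ (leqnn _))/eqP; apply/negP.
rewrite coef_derivn subnK // -[n in _`_n]/(n.+1.-1) -size_P.
rewrite -/(lead_coef _) (monicP (monic_prod_XsubC _ _ _)) natA_neq0 //.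
by rewrite ffact_gt0 leq_subr.
Qed.

(** [disc] divides by this falling factorial, a unit by [natA_unit]. *)
Lemma lead_coef_derivn_prod_XsubC r : (r <= n)%N ->
  lead_coef P^`(n - r) = (n ^_ (n - r))%:R.
Proof.
move=> rn; rewrite lead_coefE size_derivn_prod_XsubC //= coef_derivn subnK //.
rewrite -[n in _`_n]/(n.+1.-1) -size_P -/(lead_coef _).
by rewrite (monicP (monic_prod_XsubC _ _ _)).
Qed.

Lemma disc_derivn_affine (phi : {rmorphism A -> A}) (a b : A) (s : 'S_n) r :
    a != 0 -> (forall i, phi (x i) = a * x (s i) + b) -> (0 < r <= n)%N ->
  let D := disc P^`(n - r) in phi D = a ^+ (r * (r - 1)) * D.
Proof.
move=> a0 phiX /andP[r0 rn] D; set f := P^`(n - r) in D *.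
pose l := a *: 'X + b%:P.
have f'E : f^`() = P^`(n - (r - 1)).
  by rewrite -derivnS; congr (P^`(_)); lia.
(* Substituting [l] turns each factor ['X - phi (x i)] into [a] times ['X - x (s i)]. *)
have phiP : map_poly phi P \Po l = a ^+ n *: P.
  rewrite /P !rmorph_prod /= -mul_polyC rmorphXn.
  have -> : a%:P ^+ n = \prod_(i < n) a%:P by rewrite prodr_const card_ord.
  rewrite [X in _ * X](reindex_inj (@perm_inj _ s)) -big_split /=; apply: eq_bigr => i _.
  rewrite rmorphB /= map_polyX map_polyC /= phiX comp_polyB comp_polyX comp_polyC.
  by rewrite /l -mul_polyC polyCD polyCM mulrBr opprD addrACA subrr addr0.
(* Each of the [n - k] derivations of the composite brings out one [a], which leaves [a ^+ k] of
   [a ^+ n]. *)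
have phiD k : (k <= n)%N -> map_poly phi P^`(n - k) \Po l = a ^+ k *: P^`(n - k).
  move=> kn; have ank0 : (a ^+ (n - k))%:P != 0 by rewrite polyC_eq0 expf_neq0.
  apply: (mulfI ank0); rewrite !mul_polyC -derivn_map -derivn_comp_affine phiP.
  by rewrite derivnZ scalerA -exprD subnK.
have phif := phiD r rn.
have phif' := phiD (r - 1)%N (leq_trans (leq_subr _ _) rn); rewrite -f'E in phif'.
have sf : size f = r.+1 by apply: size_derivn_prod_XsubC.
have lf : lead_coef f = (n ^_ (n - r))%:R by apply: lead_coef_derivn_prod_XsubC.
have n0 k : (0 < n ^_ (n - k))%N by rewrite ffact_gt0 leq_subr.
have sf' : size f^`() = r.
  by rewrite f'E size_derivn_prod_XsubC ?(leq_trans (leq_subr _ _)) // subn1 prednK.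
have lf' : lead_coef f^`() = (n ^_ (n - (r - 1)))%:R.
  by rewrite f'E lead_coef_derivn_prod_XsubC ?(leq_trans (leq_subr _ _)).
(* Substitution multiplies the left side by [a ^+ (r * (r - 1))], while the scalars [a ^+ r] and
   [a ^+ (r - 1)] give the square of this power on the right; one copy cancels. *)
have res : phi (resultant f f^`()) = a ^+ (r * (r - 1)) * resultant f f^`().
  apply: (mulfI (expf_neq0 (r * (r - 1)) a0)).
  rewrite -resultant_map ?lf ?lf' ?rmorph_nat ?natA_neq0 //.
  have := @resultant_comp_affine _ (map_poly phi f) (map_poly phi f^`()) a b a0.
  rewrite phif phif' resultantZ ?expf_neq0 //.
  rewrite !size_map_poly_id0 ?lf ?lf' ?rmorph_nat ?natA_neq0 //.
  rewrite sf sf' /= -subn1 => <-.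
  by rewrite -/f mulrA -!exprM [((r - 1) * r)%N]mulnC.
(* The sign and the leading coefficient are integers, hence fixed by [phi]. *)
rewrite /D /disc sf lf !rmorphM rmorphXn rmorphN1 res.
by rewrite rmorphV ?natA_unit //= rmorph_nat mulrCA.
Qed.

End DiscDerivnProd.

(** * Homogeneity, symmetry and translation invariance of the discriminant *)

Section Polynomials.
Variables (R : realType) (n : nat).

Lemma msym_X s i : msym s ('X_i : {mpoly R[n]}) = 'X_(s i).
Proof.
rewrite msymX; congr 'X_[_]; apply/mnmP => j; rewrite !mnmE.
by rewrite -[in RHS](permKV s j) (inj_eq perm_inj).
Qed.

Lemma mcoeff_comp_scale (p : {mpoly R[n]}) c m :
  (p \mPo [tuple c *: 'X_i | i < n])@_m = c ^+ mdeg m * p@_m.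
Proof.
rewrite comp_mpolyEX raddf_sum [p in RHS]mpolyE raddf_sum mulr_sumr /=.
apply: eq_bigr => k _; rewrite !mcoeffZ mcoeffX comp_mpolyX.
under eq_bigr do rewrite tnth_mktuple exprZn.
rewrite scaler_prod prodrXr -mdegE -mpolyXE_id mcoeffZ mcoeffX.
by case: eqP => [->|_]; rewrite ?mulr0 ?mulr1 // mulrC.
Qed.

(** The coefficient at [m] is multiplied by 2 to the power [mdeg m]; as powers of 2 are distinct,
    this one scaling determines the degree. *)
Lemma dhomog_comp_scale (p : {mpoly R[n]}) d :
  p \mPo [tuple 2%:R *: 'X_i | i < n] = 2%:R ^+ d * p -> p \is d.-homog.
Proof.
move=> hp; apply/dhomogP => m; rewrite mcoeff_msupp => pm.
have := congr1 (mcoeff m) hp; rewrite mcoeff_comp_scale.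
rewrite -[in RHS]natrX [in RHS]mulr_natl mcoeffMn -[in RHS]mulr_natl natrX.
move=> /(mulIf pm)/eqP.
by rewrite -!natrX eqr_nat eqn_exp2l // => /eqP.
Qed.

Lemma PST_disc_derivn r : (0 < r <= n)%N ->
  PST (r * (r - 1)) (disc (generic_poly R n)^`(n - r)).
Proof.
move=> hr.
have unit_nat k : (0 < k)%N -> k%:R \is a @GRing.unit {mpoly R[n]}.
  move=> k0; rewrite -mpolyC_nat; apply: rmorph_unit.
  by rewrite unitfE pnatr_eq0 -lt0n.
have E := @disc_derivn_affine _ n (fun i => 'X_i) unit_nat.
split.
- apply: dhomog_comp_scale; apply: (E _ 2%:R 0 1%g) => // [|i].
    by apply: contraTneq (unit_nat 2%N isT) => ->; rewrite unitr0.
  by rewrite /= comp_mpolyXU -tnth_nth tnth_mktuple perm1 addr0 scaler_nat mulr_natl.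
- apply/issymP => s; rewrite -[RHS]mul1r -(expr1n _ (r * (r - 1))).
  apply: (E _ 1 0 s) => // [|i]; first exact: oner_neq0.
  by rewrite /= msym_X mul1r addr0.
- move=> c; rewrite -[RHS]mul1r -(expr1n _ (r * (r - 1))).
  apply: (E _ 1 c%:MP 1%g) => // [|i]; first exact: oner_neq0.
  by rewrite /= comp_mpolyXU -tnth_nth tnth_mktuple perm1 mul1r.
Qed.

End Polynomials.

(** * Invariance of degree and symmetrization under relabelling *)

Section Relabelling.
Variable n : nat.
Implicit Types (G : mgraph n) (s : 'S_n).

Lemma relabel_subproof G s : mgraph_axiom (\matrix_(i, j) G (s i) (s j)).
Proof.
apply/andP; split; last by apply/forallP => i; rewrite mxE mgraph_loopless.
by apply/eqP/matrixP => i j; rewrite !mxE mgraph_sym.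
Qed.

Definition relabel G s : mgraph n := MGraph (relabel_subproof G s).

Lemma mg_square_relabel G s : mg_square G -> mg_square (relabel G s).
Proof.
move=> /forallP sqG; apply/forallP => i; apply/forallP => j; rewrite mxE.
exact: (forallP (sqG _)).
Qed.

(** Counting every edge from both ends removes the order of the labels from the sum, which can then
    be reindexed freely. *)
Lemma double_mg_degree G : (mg_degree G).*2 = (\sum_(i < n) \sum_(j < n) G i j)%N.
Proof.
have E i : (\sum_(j < n) G i j =
    \sum_(j < n | i < j) G i j + \sum_(j < n | j < i) G i j)%N.
  rewrite (bigID (fun j : 'I_n => (i < j)%N)) /=; congr addn.
  rewrite [LHS](bigD1 i) ?ltnn //= mgraph_loopless add0n; apply: eq_bigl => j.
  by rewrite -leqNgt [(j < i)%N]ltn_neqAle andbC.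
under [RHS]eq_bigr do rewrite E.
rewrite big_split /= -addnn; congr addn.
rewrite /mg_degree; under eq_bigr do rewrite big_mkcond.
rewrite exchange_big; apply: eq_bigr => i _; rewrite -big_mkcond.
by apply: eq_bigr => j _; rewrite mgraph_sym.
Qed.

Lemma mg_degree_relabel G s : mg_degree (relabel G s) = mg_degree G.
Proof.
apply: double_inj; rewrite !double_mg_degree.
rewrite [RHS](reindex_inj (@perm_inj _ s)); apply: eq_bigr => i _.
by rewrite [RHS](reindex_inj (@perm_inj _ s)); apply: eq_bigr => j _; rewrite mxE.
Qed.

(** Up to orientation, which even multiplicities make irrelevant, relabelling permutes the
    variables, and the sum over the symmetric group absorbs this. *)
Lemma symmetrization_relabel (R : realType) G s : mg_square G ->
  symmetrization R (relabel G s) = symmetrization R G.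
Proof.
move=> sqG.
have E : msym s (graph_monomial R (relabel G s)) = graph_monomial R G.
  (* This orientation is chosen so that [o (s i) (s j)] is [i < j]. *)
  pose o (i j : 'I_n) := (perm_inv s i < perm_inv s j)%N.
  rewrite -(@graph_monomial_orientation R n G o sqG); last first.
    move=> i j ij; rewrite /o -leqNgt ltn_neqAle; case: eqP => // /val_inj/perm_inj ji.
    by rewrite ji eqxx in ij.
  rewrite [RHS](reindex_inj (@perm_inj _ s)) rmorph_prod; apply: eq_bigr => i _.
  rewrite [RHS](reindex_inj (@perm_inj _ s)) rmorph_prod; apply: eq_big => j.
    rewrite /o !permK (inj_eq perm_inj); case: eqP => // ->; exact: ltnn.
  by move=> _; rewrite rmorphXn rmorphB /= !msym_X mxE.
rewrite /symmetrization -E [LHS](reindex_inj (mulgI s)).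
by apply: eq_bigr => t _; rewrite msymMm.
Qed.

End Relabelling.

(** * Adjoining and removing isolated vertices *)

Lemma mg_square_adjoin v (G : mgraph v) n :
  mg_square G -> mg_square (adjoin_isolated G n).
Proof.
move=> /forallP sqG; apply/forallP => i; apply/forallP => j; rewrite mxE.
by case: insub => [a|] //; case: insub => [b|] //; apply: (forallP (sqG a)).
Qed.

Lemma sum_insub v n (F : option 'I_v -> nat) : (v <= n)%N -> F None = 0%N ->
  (\sum_(i < n) F (insub (val i)) = \sum_(a < v) F (Some a))%N.
Proof.
move=> vn F0; rewrite (bigID (fun i : 'I_n => (i < v)%N)) /=.
rewrite [X in (_ + X)%N]big1 ?addn0 => [|i /negPf iv]; last by rewrite insubF.
rewrite (big_ord_narrow vn); apply: eq_bigr => a _ /=.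
by rewrite -/(val a) valK.
Qed.

Lemma mg_degree_adjoin v (G : mgraph v) n : (v <= n)%N ->
  mg_degree (adjoin_isolated G n) = mg_degree G.
Proof.
move=> vn; apply: double_inj; rewrite !double_mg_degree.
pose F (x y : option 'I_v) :=
  if x is Some a then if y is Some b then G a b else 0%N else 0%N.
rewrite -(@sum_insub v n (fun x => \sum_(b < v) F x (Some b))%N) //; last first.
  by rewrite big1.
apply: eq_bigr => i _; rewrite -(@sum_insub v n (F (insub (val i)))) //; last first.
  by case: insub.
by apply: eq_bigr => j _; rewrite mxE.
Qed.

(** List the elements of [S] first and those of its complement after them. *)
Lemma set_initial_perm n (S : {set 'I_n}) :
  exists s : 'S_n, forall i : 'I_n, (s i \in S) = (i < #|S|)%N.
Proof.
pose L := enum S ++ enum (~: S).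
have sL : size L = n by rewrite size_cat -!cardE cardsC card_ord.
have uL : uniq L.
  rewrite cat_uniq !enum_uniq andbT /=; apply/hasPn => x.
  by rewrite !mem_enum inE.
have inj : injective (fun i : 'I_n => nth i L i).
  move=> i j; rewrite (set_nth_default i) ?sL // => /eqP.
  by rewrite nth_uniq ?sL // => /eqP/val_inj.
exists (perm inj) => i; rewrite permE nth_cat -cardE.
case: ltnP => iS; first by rewrite -mem_enum mem_nth // -cardE.
apply/negP; rewrite -[_ \in S]negbK -in_setC -mem_enum mem_nth //.
by rewrite -cardE cardsCs setCK card_ord ltn_sub2r // (leq_ltn_trans iS).
Qed.

(** Move the set [S] of non-isolated vertices to the front and restrict the graph to it. *)
Lemma square_graph_reduction n (G : mgraph n) : mg_square G ->
  exists v (H : mgraph v) (s : 'S_n),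
    [/\ mg_square H, no_isolated H, (v <= mg_degree G)%N, (v <= n)%N
      & adjoin_isolated H n = relabel G s].
Proof.
move=> sqG; pose S := [set i | [exists j, 0 < G i j]%N]; pose v := #|S|.
have [s sP] := set_initial_perm S.
have vn : (v <= n)%N by rewrite -[leqRHS]card_ord max_card.
pose w : 'I_v -> 'I_n := widen_ord vn.
have HP : mgraph_axiom (\matrix_(a, b) relabel G s (w a) (w b)).
  apply/andP; split; last by apply/forallP => i; rewrite !mxE mgraph_loopless.
  by apply/eqP/matrixP => i j; rewrite !mxE mgraph_sym.
have outS i j : s i \notin S -> G (s i) (s j) = 0%N.
  rewrite inE => /existsPn/(_ (s j)); by case: (G _ _).
have GS i j : G (s i) (s j) != 0%N -> (i < v)%N.
  by rewrite -sP; apply: contraR => /outS ->.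
exists v, (MGraph HP), s; split => //.
- apply/forallP => i; apply/forallP => j; rewrite mxE.
  exact: (forallP (forallP (mg_square_relabel s sqG) _)).
(* A neighbour of a vertex in [S] is itself non-isolated, so its new label is below [v]. *)
- apply/forallP => a; have : s (w a) \in S by rewrite sP /=.
  rewrite inE => /existsP[k Gk]; have kv : (perm_inv s k < v)%N.
    by apply: (GS _ (w a)); rewrite mgraph_sym permKV -lt0n.
  apply/existsP; exists (Ordinal kv); rewrite !mxE.
  rewrite (_ : s (w (Ordinal kv)) = k) // -[RHS](permKV s).
  by congr (s _); apply: val_inj.
(* A positive even multiplicity is at least 2, so each vertex of [S] contributes at least 2 to the
   doubled degree. *)
- rewrite -leq_double double_mg_degree -muln2 -sum_nat_const.
  rewrite [leqRHS](bigID (mem S)) /= -[leqLHS]addn0 leq_add //.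
  apply: leq_sum => i.
  rewrite inE => /existsP[j Gij]; rewrite (bigD1 j) //= ltn_addr //.
  by have := forallP (forallP sqG i) j; case: (G i j) Gij => [|[]].
- apply/val_inj/matrixP => i j; rewrite !mxE.
  case: insubP => [a _ ai|]; last first.
    by move/negP=> iv; apply/esym/eqP; apply: contraT => /GS.
  case: insubP => [b _ bj|]; last first.
    by move/negP=> jv; apply/esym/eqP; rewrite mgraph_sym; apply: contraT => /GS.
  by rewrite !mxE; congr (G (s _) (s _)); apply: val_inj.
Qed.

(** * The finite collection of generators *)

(** Bounded entries make the matrices a finite type; [d.*2], the sum of all entries, is a crude
    bound. [insub] keeps the adjacency matrices. *)
Definition square_graphs d v : seq (mgraph v) :=
  [seq G <- pmap insub [seq map_mx (val : 'I_d.*2.+1 -> nat) A | A <- enum {: 'M_v}]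
     | [&& mg_square G, no_isolated G & mg_degree G == d]].

Lemma mem_square_graphs d v (G : mgraph v) : (G \in square_graphs d v) =
  [&& mg_square G, no_isolated G & mg_degree G == d].
Proof.
rewrite mem_filter; case: and3P => //= -[_ _ /eqP dG].
rewrite mem_pmap_sub; apply/mapP.
have le i j : (G i j < d.*2.+1)%N.
  by rewrite -dG double_mg_degree ltnS (bigD1 i) //= (bigD1 j) //= -addnA leq_addr.
exists (\matrix_(i, j) Ordinal (le i j)); first by rewrite mem_enum.
by apply/matrixP => i j; rewrite !mxE.
Qed.

(** The range starts at 0 because for [d = 0] the only member is the graph with no vertices. *)
Definition square_collection d : seq {v : nat & mgraph v} :=
  [seq Tagged mgraph G | v <- iota 0 d.+1, G <- square_graphs d v].

Lemma square_collectionP d G : reflect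
  [/\ mg_square (tagged G), no_isolated (tagged G), (tag G <= d)%N
    & mg_degree (tagged G) = d] (G \in square_collection d).
Proof.
apply: (iffP allpairsPdep) => [[v [H [vd HH ->]]]|].
  move: HH; rewrite mem_square_graphs => /and3P[-> -> /eqP->].
  by move: vd; rewrite mem_iota.
case: G => v G [sG iG vd dG]; exists v, G.
by rewrite mem_iota mem_square_graphs sG iG dG /= ltnS vd eqxx.
Qed.

Lemma cone_generated_by_mono (R : realType) n (S T : {mpoly R[n]} -> Prop) p :
  (forall q, S q -> T q) -> cone_generated_by S p -> cone_generated_by T p.
Proof.
move=> ST [k [c [q [cq pE]]]]; exists k, c, q; split => // i.
by have [? /ST] := cq i.
Qed.

(** Both cones have the same generators: reduction and relabelling give one inclusion, adjoining
    vertices the other, as [v <= d <= n]. *)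
Lemma square_collection_generates (R : realType) d :
  generates_square_cones R d (square_collection d).
Proof.
move=> n dn p; split; apply: cone_generated_by_mono => q.
  case=> G [sqG dG ->].
  have [v [H [s [sqH iH vd vn HE]]]] := square_graph_reduction sqG.
  exists (Tagged mgraph H) => /=; last by rewrite HE symmetrization_relabel.
  apply/square_collectionP; split => //=; first by rewrite -dG.
  by rewrite -(mg_degree_adjoin H vn) HE mg_degree_relabel.
case=> G /square_collectionP[sqG _ vd dG] ->.
exists (adjoin_isolated (tagged G) n); split => //; first exact: mg_square_adjoin.
by rewrite mg_degree_adjoin // (leq_trans vd).
Qed.

Theorem proposition16 (R : realType) :
  (forall d : nat, ~~ odd d ->
     exists H : seq {v : nat & mgraph v},
       (forall G : {v : nat & mgraph v}, G \in H ->
          [/\ mg_square (tagged G), no_isolated (tagged G) & (tag G <= d)%N]) /\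
       generates_square_cones R d H) /\
  (forall r : nat, (2 <= r)%N ->
     ~~ odd (r * (r - 1)) /\
     (forall n : nat, (r <= n)%N ->
        PST (r * (r - 1)) (disc (generic_poly R n)^`(n - r))) /\
     exists H : seq {v : nat & mgraph v},
       (forall G : {v : nat & mgraph v}, G \in H ->
          [/\ mg_square (tagged G), no_isolated (tagged G)
            & (tag G <= r * (r - 1))%N]) /\
       generates_square_cones R (r * (r - 1)) H /\
       (forall n : nat, (r * (r - 1) <= n)%N ->
          square_graph_cone (r * (r - 1)) (disc (generic_poly R n)^`(n - r)) <->
          collection_cone H (disc (generic_poly R n)^`(n - r)))).
Proof.
split=> [d _|r r2].
  exists (square_collection d); split; last exact: square_collection_generates.
  by move=> G /square_collectionP[].
split; first by rewrite subn1 oddM; case: r r2 => //= r _; rewrite andNb.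
split=> [n rn|]; first by apply: PST_disc_derivn; rewrite rn (leq_trans _ r2).
exists (square_collection (r * (r - 1))%N); split.
  by move=> G /square_collectionP[].
have gen := @square_collection_generates R (r * (r - 1))%N.
by split=> // n rn; apply: gen.
Qed.
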